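(* Consider $n$ agents indexed by $\mathcal{V}=\{1,\dots,n\}$ over a fixed directed strongly connected graph with nonnegative weights $a_{ij}$ ($a_{ij}>0$ iff $j\in N_i$) and Laplacian $L$. Assume the CFP solution set $\mathbf{X}^*$ is non-empty and that there is $K\ge0$ with $\|\nabla g_i^+(x)\|\le K$ for all $x$ and all $i$. Let $\{\alpha(t)\},\{\beta(t)\}$ be sequences with (a) $\alpha(t)\in[0,1]$, $\sum_{t=0}^\infty\alpha(t)=\infty$, $\sum_{t=0}^\infty\alpha^2(t)<\infty$; (b) $\beta(t)\ge0$, $\sum_{t=0}^\infty\beta(t)=\infty$, $\sum_{t=0}^\infty\beta^2(t)<\infty$. Let $0<h<\varrho$, where $$\varrho=\min\Big[\frac{1}{\max_{1\le i\le n}\sum_{j=1}^n a_{ij}},\ \min_{2\le i\le n}\frac{2\,\mathrm{Re}(\lambda_i(L))}{|\lambda_i(L)|^2}\Big].$$ The agents' states $x_i(t)\in\mathbb{R}^m$ evolve by $x_i(t+1)=x_i(t)+u_i(t)$, $t=0,1,2,\dots$, with $$y_i(t)=x_i(t)+h\sum_{j\in N_i}a_{ij}(x_j(t)-x_i(t)),\quad \nabla_i(t)=\beta(t)\nabla g_i^+(y_i(t)),\quad \xi_i(t)=y_i(t)-\nabla_i(t),$$ $$\varphi_i(t)=\alpha(t)\big(\xi_i(t)-P_{X_i}(\xi_i(t))\big),\quad \phi_i(t)=-\nabla_i(t)-\varphi_i(t),\quad u_i(t)=h\sum_{j\in N_i}a_{ij}(x_j(t)-x_i(t))+\phi_i(t).$$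 Then the agents reach consensus asymptotically and there is $x^*\in\mathbf{X}^*$ with $\lim_{t\to\infty}x_i(t)=x^*$ for all $i$.
   Context: For each $i$, $g_i:\mathbb{R}^m\to\mathbb{R}$ is convex and continuous, $X_i\subset\mathbb{R}^m$ closed convex, $X=\bigcap_i X_i$; the CFP asks for $x$ with $g_i(x)\le0$ for all $i$ and $x\in X$, with solution set $\mathbf{X}^*$. $g_i^+=\max[g_i,0]$; $\nabla g_i^+(y)$ denotes a subgradient of $g_i^+$ at $y$ (chosen as $0$ if $g_i(y)\le 0$ and as a subgradient of $g_i$ otherwise); $P_{X_i}$ is Euclidean projection onto $X_i$. The Laplacian $L=(l_{ij})$ has $l_{ij}=-a_{ij}$ for $i\ne j$ and $l_{ii}=\sum_j a_{ij}$; since the graph has a spanning tree, $L$ has a simple eigenvalue $\lambda_1(L)=0$ and its other eigenvalues $\lambda_2(L),\dots,\lambda_n(L)$ have positive real parts. Consensus means $\|x_i(t)-x_j(t)\|\to0$ for all $i,j$. *)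

(* Defs.v *)
From HB Require Import structures.
From mathcomp Require Import all_boot all_order all_algebra.
From mathcomp Require Import all_classical all_reals all_analysis.
From mathcomp Require Import complex.
From mathcomp Require Import matrix_topology matrix_normedtype.
Import numFieldNormedType.Exports.
Set Implicit Arguments. Unset Strict Implicit. Unset Printing Implicit Defensive.
Import Order.TTheory GRing.Theory Num.Theory.
Local Open Scope ring_scope.
Local Open Scope classical_set_scope.

Section Defs.
Variables (R : realType) (m : nat).

Definition dotv (u v : 'rV[R]_m) : R := \sum_(k < m) u 0 k * v 0 k.
Definition enorm (v : 'rV[R]_m) : R := Num.sqrt (dotv v v).

Definition is_proj (A : set 'rV[R]_m) (P : 'rV[R]_m -> 'rV[R]_m) : Prop :=
  forall z, A (P z) /\ forall y, A y -> enorm (z - P z) <= enorm (z - y).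

(* dg is a choice of subgradient of g^+ = max(g,0): 0 where g <= 0,
   a subgradient of g elsewhere. *)
Definition is_subgrad_plus (g : 'rV[R]_m -> R) (dg : 'rV[R]_m -> 'rV[R]_m) : Prop :=
  forall y, (g y <= 0 -> dg y = 0) /\
            (0 < g y -> forall z, g y + dotv (dg y) (z - y) <= g z).
End Defs.

Definition laplacian (R : realType) (n : nat) (a : 'I_n -> 'I_n -> R) : 'M[R]_n :=
  \matrix_(i, j) (if i == j then \sum_(k < n) a i k else - a i j).

Definition strongly_connected (R : realType) (n : nat) (a : 'I_n -> 'I_n -> R) : Prop :=
  forall i j : 'I_n, connect (fun i' j' => 0 < a i' j') i j.

Definition nbsum (R : realType) (n m : nat) (a : 'I_n -> 'I_n -> R)
  (x : 'I_n -> 'rV[R]_m) (i : 'I_n) : 'rV[R]_m :=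
  \sum_(j | 0 < a i j) a i j *: (x j - x i).

(* Main.v *)
(* The averaging step is y_i = sum_j w_ij x_j with w row-stochastic, irreducible
   and with positive diagonal (this only uses h * max_i sum_j a_ij < 1), so w has
   a positive left fixed vector p.  For z solving the CFP, the weighted energy
   V_z = sum_i p_i |x_i - z|^2 satisfies
     V_z(t+1) + sum_ij p_i w_ij |x_j - y_i|^2 + 2 beta sum_i p_i g_i^+(y_i)
       + alpha sum_i p_i |xi_i - P_i xi_i|^2 <= V_z(t) + O(beta^2),
   so all the terms on the left are summable.  The variance term gives consensus
   along edges, hence everywhere.  As alpha is not summable, the projection
   residuals are small along a subsequence, with a cluster point q in every X_i.
   Since alpha and beta may be active at different times, g_i(q) <= 0 needs an
   extra argument: the projections do not increase V_q, so if g_i(q) > 0 then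
   near q the drift is controlled by the summable beta g_i^+(y_i) and the states
   never leave, which makes beta summable.  So q is a solution, V_q is
   almost decreasing and tends to 0 along a subsequence, hence tends to 0. *)
Require Import Defs.
From HB Require Import structures.
From mathcomp Require Import all_boot all_order all_algebra.
From mathcomp Require Import all_classical all_reals all_analysis.
From mathcomp Require Import complex.
From mathcomp Require Import matrix_topology matrix_normedtype.
From mathcomp Require Import ring lra.
Import numFieldNormedType.Exports.
Import Order.TTheory GRing.Theory Num.Theory.
Local Open Scope ring_scope.
Local Open Scope classical_set_scope.
Set Implicit Arguments. Unset Strict Implicit. Unset Printing Implicit Defensive.

(** * The squared Euclidean norm, projections and subgradients *)

(** The square of [enorm]: without roots, estimates become linear inequalities between inner
    products. *)
Definition sqnorm (R : realType) (m : nat) (v : 'rV[R]_m) : R := dotv v v.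

Lemma dotvC (R : realType) m (u v : 'rV[R]_m) : dotv u v = dotv v u.
Proof. by apply: eq_bigr => k _; rewrite mulrC. Qed.

Lemma dotvDl (R : realType) m (u v w : 'rV[R]_m) :
  dotv (u + v) w = dotv u w + dotv v w.
Proof. by rewrite -big_split; apply: eq_bigr => k _; rewrite mxE mulrDl. Qed.

Lemma dotvDr (R : realType) m (u v w : 'rV[R]_m) :
  dotv u (v + w) = dotv u v + dotv u w.
Proof. by rewrite dotvC dotvDl !(dotvC u). Qed.

Lemma dotvZl (R : realType) m c (u v : 'rV[R]_m) :
  dotv (c *: u) v = c * dotv u v.
Proof. by rewrite mulr_sumr; apply: eq_bigr => k _; rewrite mxE mulrA. Qed.

Lemma dotvZr (R : realType) m c (u v : 'rV[R]_m) :
  dotv u (c *: v) = c * dotv u v.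
Proof. by rewrite dotvC dotvZl dotvC. Qed.

Lemma dotvNl (R : realType) m (u v : 'rV[R]_m) : dotv (- u) v = - dotv u v.
Proof. by rewrite -scaleN1r dotvZl mulN1r. Qed.

Lemma dotvNr (R : realType) m (u v : 'rV[R]_m) : dotv u (- v) = - dotv u v.
Proof. by rewrite dotvC dotvNl dotvC. Qed.

Lemma dotv0l (R : realType) m (v : 'rV[R]_m) : dotv 0 v = 0.
Proof. by rewrite -(scale0r (0 : 'rV[R]_m)) dotvZl mul0r. Qed.

Lemma dotv_suml (R : realType) m n (u : 'I_n -> 'rV[R]_m) (v : 'rV[R]_m) :
  dotv (\sum_i u i) v = \sum_i dotv (u i) v.
Proof.
apply: (big_morph (fun w => dotv w v)) => [u1 u2|]; last exact: dotv0l.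
exact: dotvDl.
Qed.

Definition dotvE := (dotvDl, dotvDr, dotvNl, dotvNr, dotvZl, dotvZr).

Lemma sqnorm_ge0 (R : realType) m (v : 'rV[R]_m) : 0 <= sqnorm v.
Proof. by apply: sumr_ge0 => k _; rewrite -expr2 sqr_ge0. Qed.

Lemma sqnormZ (R : realType) m c (v : 'rV[R]_m) :
  sqnorm (c *: v) = c ^+ 2 * sqnorm v.
Proof. by rewrite /sqnorm dotvZl dotvZr mulrA. Qed.

Lemma sqnormBC (R : realType) m (u v : 'rV[R]_m) : sqnorm (u - v) = sqnorm (v - u).
Proof. by rewrite -opprB -scaleN1r sqnormZ sqrrN expr1n mul1r. Qed.

Lemma sqnormD_le (R : realType) m (u v : 'rV[R]_m) :
  sqnorm (u + v) <= 2 * sqnorm u + 2 * sqnorm v.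
Proof.
have := sqnorm_ge0 (u - v).
rewrite /sqnorm !dotvE (dotvC v u); lra.
Qed.

Lemma sqnormB_le (R : realType) m (u v w : 'rV[R]_m) :
  sqnorm (u - w) <= 2 * sqnorm (u - v) + 2 * sqnorm (v - w).
Proof. by rewrite -(subrKA v u (- w)) sqnormD_le. Qed.

Lemma enorm_le_sqnorm (R : realType) m (u v : 'rV[R]_m) :
  enorm u <= enorm v -> sqnorm u <= sqnorm v.
Proof. by rewrite ler_sqrt // sqnorm_ge0. Qed.

Lemma enorm_le_sqr (R : realType) m (u : 'rV[R]_m) c :
  enorm u <= c -> sqnorm u <= c ^+ 2.
Proof.
move=> uc; rewrite -[sqnorm u]sqr_sqrtr ?sqnorm_ge0 //.
by rewrite ler_pXn2r ?nnegrE ?(le_trans (sqrtr_ge0 _) uc) // sqrtr_ge0.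
Qed.

(** Bias-variance decomposition: expand around [y]; the cross terms cancel because the weighted
    deviations [x j - y] sum to zero. *)
Lemma sqnorm_mean (R : realType) m n (w : 'I_n -> R) (x : 'I_n -> 'rV[R]_m) z :
  \sum_j w j = 1 ->
  let y := \sum_j w j *: x j in
  sqnorm (y - z) + \sum_j w j * sqnorm (x j - y) =
  \sum_j w j * sqnorm (x j - z).
Proof.
move=> w1 y.
have centered : \sum_j w j *: (x j - y) = 0.
  under eq_bigr do rewrite scalerBr.
  by rewrite sumrB -scaler_suml w1 scale1r subrr.
transitivity (\sum_j (w j * sqnorm (y - z) + w j * sqnorm (x j - y) +
                      dotv (w j *: (x j - y)) (2 *: (y - z)))).
  by rewrite !big_split /= -mulr_suml w1 mul1r -dotv_suml centered dotv0l addr0.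
apply: eq_bigr => j _; rewrite -(subrKA y (x j) (- z)) /sqnorm.
move: (x j - y) (y - z) => u v; rewrite !dotvE (dotvC v u); ring.
Qed.

Lemma proj_variational (R : realType) m (A : set 'rV[R]_m) P z y :
  convex_set A -> is_proj A P -> A y -> dotv (z - P z) (y - P z) <= 0.
Proof.
move=> cA PA Ay; have [APz Pmin] := PA z.
set p := P z in APz Pmin *; set c := dotv _ _; rewrite leNgt; apply/negP => c0.
(* Compares [P z] with the point at parameter [s] on the segment from [P z] to [y]. *)
have key s : 0 <= s -> s <= 1 -> 0 <= s * (s * sqnorm (y - p) - 2 * c).
  move=> s0 s1.
  have Aq : A (s *: y + (1 - s) *: p).
    have := cA y p (Itv01 s0 s1); rewrite !inE => /(_ Ay APz).
    by rewrite /conv /=.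
  have := enorm_le_sqnorm (Pmin _ Aq).
  have -> : z - (s *: y + (1 - s) *: p) = (z - p) + (- s) *: (y - p).
    by apply/rowP => k; rewrite !mxE; ring.
  rewrite /c /sqnorm; move: (z - p) (y - p) => u v.
  rewrite !dotvE (dotvC v u); nra.
have d0 := sqnorm_ge0 (y - p); set d := sqnorm _ in key d0.
(* This [s] lies in (0, 1] and satisfies [s * d <= c], so the second factor in [key] is at most
   [- c], which is negative. *)
pose s := c / (d + c).
have s0 : 0 < s by rewrite divr_gt0 //; lra.
have s1 : s <= 1 by rewrite ler_pdivrMr ?mul1r; lra.
have := key s (ltW s0) s1; rewrite pmulr_rge0 //.
have sd : s * d <= c.
  by rewrite /s mulrAC ler_pdivrMr ?ler_wpM2l; lra.
lra.
Qed.

(** With u = z - P z and v = z - y, the variational inequality reads |u|^2 <= <u, v>. Hence |v - s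
    u|^2 <= |v|^2 - s (2 - s) |u|^2, and s (2 - s) >= s on [0, 1]. *)
Lemma relaxed_proj_le (R : realType) m (A : set 'rV[R]_m) P z y s :
  convex_set A -> is_proj A P -> A y -> 0 <= s <= 1 ->
  sqnorm (z - s *: (z - P z) - y) + s * sqnorm (z - P z) <= sqnorm (z - y).
Proof.
move=> cA PA Ay /andP[s0 s1].
have := proj_variational z cA PA Ay.
have := sqnorm_ge0 (z - P z).
have -> : z - s *: (z - P z) - y = (z - y) + (- s) *: (z - P z).
  by apply/rowP => k; rewrite !mxE; ring.
have -> : y - P z = (z - P z) - (z - y).
  by apply/rowP => k; rewrite !mxE; ring.
rewrite /sqnorm; move: (z - P z) (z - y) => u v.
rewrite !dotvE (dotvC v u); set d := dotv u u; set c := dotv u v => d0 dc.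
have := mulr_ge0 s0 (mulr_ge0 (_ : 0 <= 1 - s) d0).
have := mulr_ge0 s0 (_ : 0 <= c - d).
move=> /(_ ltac:(lra)) + /(_ ltac:(lra)); lra.
Qed.

Lemma subgrad_dotv_ge (R : realType) m (g : 'rV[R]_m -> R) dg y z :
  is_subgrad_plus g dg -> g z <= 0 -> Num.max (g y) 0 <= dotv (dg y) (y - z).
Proof.
move=> dgP gz; have [dg0 dgpos] := dgP y.
have [gy|gy] := leP (g y) 0; first by rewrite dg0 // dotv0l.
have := dgpos gy z; rewrite -opprB dotvNr; lra.
Qed.

(** * Nonnegative series and almost decreasing sequences *)

(** For nonnegative terms this is convergence of the series; likewise, for nonnegative sequences,
    [vanishes] is convergence to 0 and [recurrent] says that the lower limit is 0. *)
Definition bounded_sums (R : realType) (f : nat -> R) :=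
  exists B, forall n, \sum_(0 <= t < n) f t <= B.

Definition vanishes (R : realType) (f : nat -> R) :=
  forall e, 0 < e -> exists N, forall t, (N <= t)%N -> f t < e.

Definition recurrent (R : realType) (f : nat -> R) :=
  forall e N, 0 < e -> exists2 t, (N <= t)%N & f t < e.

Lemma vanishes_le (R : realType) (f g : nat -> R) :
  (forall t, f t <= g t) -> vanishes g -> vanishes f.
Proof.
move=> fg g0 e /g0 [N NP]; exists N => t /NP; exact: le_lt_trans.
Qed.

Lemma vanishesD (R : realType) (f g : nat -> R) :
  vanishes f -> vanishes g -> vanishes (fun t => f t + g t).
Proof.
move=> f0 g0 e e0; have e2 : 0 < e / 2 by rewrite divr_gt0.
have [N NP] := f0 _ e2; have [M MP] := g0 _ e2; exists (maxn N M) => t.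
rewrite geq_max => /andP[/NP + /MP]; lra.
Qed.

Lemma vanishesZ (R : realType) c (f : nat -> R) :
  0 <= c -> vanishes f -> vanishes (fun t => c * f t).
Proof.
move=> c0 f0 e e0; have c1 : 0 < c + 1 by lra.
have [N NP] := f0 _ (divr_gt0 e0 c1); exists N => t /NP.
rewrite ltr_pdivlMr // => fe; have [f_ge0|f_lt0] := leP 0 (f t); nra.
Qed.

Lemma vanishes_sum (R : realType) n (f : 'I_n -> nat -> R) :
  (forall i, vanishes (f i)) -> vanishes (fun t => \sum_i f i t).
Proof.
elim: n f => [|n IH] f f0.
  by move=> e e0; exists 0%N => t _; rewrite big_ord0.
have init := IH _ (fun i => f0 (widen_ord (leqnSn n) i)).
apply: vanishes_le (vanishesD init (f0 ord_max)) => t.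
by rewrite big_ord_recr.
Qed.

Lemma recurrent_le (R : realType) (f g : nat -> R) :
  (forall t, f t <= g t) -> recurrent g -> recurrent f.
Proof.
move=> fg g0 e N /(g0 _ N) [t Nt gt]; exists t => //; exact: le_lt_trans gt.
Qed.

Lemma recurrentD (R : realType) (f g : nat -> R) :
  recurrent f -> vanishes g -> recurrent (fun t => f t + g t).
Proof.
move=> f0 g0 e N e0; have e2 : 0 < e / 2 by rewrite divr_gt0.
have [M MP] := g0 _ e2; have [t] := f0 _ (maxn N M) e2.
rewrite geq_max => /andP[Nt /MP]; exists t => //; lra.
Qed.

Lemma recurrentZ (R : realType) c (f : nat -> R) :
  0 <= c -> recurrent f -> recurrent (fun t => c * f t).
Proof.
move=> c0 f0 e N e0; have c1 : 0 < c + 1 by lra.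
have [t Nt fte] := f0 _ N (divr_gt0 e0 c1); exists t => //; move: fte.
rewrite ltr_pdivlMr // => fe; have [f_ge0|f_lt0] := leP 0 (f t); nra.
Qed.

Lemma nneseries_bounded_sums (R : realType) (f : nat -> R) :
  (forall t, 0 <= f t) -> (\sum_(0 <= t <oo) (f t)%:E < +oo)%E ->
  bounded_sums f.
Proof.
move=> f0 foo; exists (fine (\sum_(0 <= t <oo) (f t)%:E)%E) => n.
have f0' t : (0 <= (f t)%:E)%E by rewrite lee_fin.
have Sge0 : (0 <= \sum_(0 <= t <oo) (f t)%:E)%E by apply: nneseries_ge0.
rewrite -lee_fin fineK ?ge0_fin_numE // -sumEFin.
exact: nneseries_lim_ge.
Qed.

Lemma nneseries_unbounded_sums (R : realType) (f : nat -> R) :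
  (forall t, 0 <= f t) -> (\sum_(0 <= t <oo) (f t)%:E = +oo)%E ->
  ~ bounded_sums f.
Proof.
move=> f0 foo [B fB].
suff : (\sum_(0 <= t <oo) (f t)%:E <= B%:E)%E by rewrite foo leye_eq.
apply: lime_le; first by apply: is_cvg_nneseries => t _ _; rewrite lee_fin.
by apply: nearW => n; rewrite sumEFin lee_fin.
Qed.

Lemma bounded_sums_le (R : realType) (f g : nat -> R) :
  (forall t, f t <= g t) -> bounded_sums g -> bounded_sums f.
Proof.
by move=> fg [B gB]; exists B => n; apply: le_trans (gB n); exact: ler_sum.
Qed.

Lemma bounded_sumsD (R : realType) (f g : nat -> R) :
  bounded_sums f -> bounded_sums g -> bounded_sums (fun t => f t + g t).
Proof.
by move=> [B fB] [C gC]; exists (B + C) => n; rewrite big_split lerD.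
Qed.

Lemma bounded_sumsZ (R : realType) c (f : nat -> R) :
  0 <= c -> bounded_sums f -> bounded_sums (fun t => c * f t).
Proof.
by move=> c0 [B fB]; exists (c * B) => n; rewrite -mulr_sumr ler_wpM2l.
Qed.

Lemma bounded_sums_eventually_le (R : realType) (f g : nat -> R) N :
  (forall t, 0 <= g t) -> (forall t, (N <= t)%N -> f t <= g t) ->
  bounded_sums g -> bounded_sums f.
Proof.
(* The absolute values of the first [N] terms are absorbed into the bound. *)
move=> g0 fg [B gB]; exists (\sum_(0 <= t < N) `|f t| + B) => n.
have step : \sum_(0 <= t < n) f t <=
    \sum_(0 <= t < n) (if (t < N)%N then `|f t| else 0) + \sum_(0 <= t < n) g t.
  rewrite -big_split; apply: ler_sum => t _ /=.
  case: ltnP => [_|Nt]; last by rewrite add0r fg.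
  by rewrite (le_trans (ler_norm _)) // lerDl.
apply: (le_trans step); apply: lerD => //.
rewrite -big_mkcond /=; case: (leqP N n) => Nn.
  by rewrite [leRHS](big_nat_widen 0 _ n).
rewrite (@le_trans _ _ (\sum_(0 <= t < n) `|f t|)) //.
  by rewrite big_mkcond /=; apply: ler_sum => t _; case: ifP.
by rewrite [leRHS](big_cat_nat (n := n)) ?(ltnW Nn) //= lerDl sumr_ge0.
Qed.

(** Beyond an [N] whose partial sum is within [e] of the supremum, less than [e] remains to be
    added. *)
Lemma bounded_sums_tail (R : realType) (f : nat -> R) (e : R) :
  (forall t, 0 <= f t) -> bounded_sums f -> 0 < e ->
  exists N, forall T t, (N <= T)%N -> \sum_(T <= s < t) f s < e.
Proof.
move=> f0 [B fB] e0.
pose S : set R := [set r | exists n, r = \sum_(0 <= t < n) f t].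
have hS : has_sup S.
  split; first by exists (\sum_(0 <= t < 0) f t); exists 0%N.
  by exists B => _ [n ->].
have [_ [N ->] supN] := sup_adherent e0 hS.
exists N => T t NT; have [tT|Tt] := leqP t T; first by rewrite big_geq.
have ub n : \sum_(0 <= s < n) f s <= sup S.
  by apply: ub_le_sup; [case: hS|exists n].
have := ub t; rewrite (big_cat_nat (n := T)) ?(ltnW Tt) //=.
rewrite (big_cat_nat (n := N)) //=.
have : 0 <= \sum_(N <= s < T) f s by apply: sumr_ge0.
lra.
Qed.

Lemma bounded_sums_vanishes (R : realType) (f : nat -> R) :
  (forall t, 0 <= f t) -> bounded_sums f -> vanishes f.
Proof.
move=> f0 fb e e0; have [N NP] := bounded_sums_tail f0 fb e0.
by exists N => t Nt; have := NP t t.+1 Nt; rewrite big_nat1.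
Qed.

(** If [f] stayed above [e] from some time on, [a] would eventually be dominated by the summable
    [e^-1 * (a * f)]. *)
Lemma weighted_sums_recurrent (R : realType) (a f : nat -> R) :
  (forall t, 0 <= a t) -> (forall t, 0 <= f t) -> ~ bounded_sums a ->
  bounded_sums (fun t => a t * f t) -> recurrent f.
Proof.
move=> a0 f0 aoo afb e N e0; apply: contrapT => nex; apply: aoo.
apply: (@bounded_sums_eventually_le _ _ (fun t => e^-1 * (a t * f t)) N).
- by move=> t; rewrite !mulr_ge0 // invr_ge0 ltW.
- move=> t Nt; rewrite mulrCA ler_peMr // ler_pdivlMl // mulr1 leNgt.
  by apply/negP => fe; apply: nex; exists t.
- by apply: bounded_sumsZ => //; rewrite invr_ge0 ltW.
Qed.

(* Deterministic Robbins--Siegmund lemma. *)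
Lemma quasi_decreasing_bounded_sums (R : realType) (V D e : nat -> R) :
  (forall t, 0 <= V t) -> (forall t, V t.+1 + D t <= V t + e t) ->
  bounded_sums e -> bounded_sums D.
Proof.
move=> V0 VD [B eB]; exists (V 0%N + B) => n.
have : V n + \sum_(0 <= t < n) D t <= V 0%N + \sum_(0 <= t < n) e t.
  elim: n => [|n IH]; first by rewrite !big_geq.
  rewrite !big_nat_recr //=; have := VD n; lra.
have := V0 n; have := eB n; lra.
Qed.

Lemma quasi_decreasing_le (R : realType) (V e : nat -> R) T t :
  (forall s, V s.+1 <= V s + e s) -> (T <= t)%N ->
  V t <= V T + \sum_(T <= s < t) e s.
Proof.
move=> Ve; elim: t => [|t IH].
  by rewrite leqn0 => /eqP ->; rewrite big_geq ?addr0.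
rewrite leq_eqVlt => /predU1P[->|]; first by rewrite big_geq ?addr0.
rewrite ltnS => Tt; rewrite big_nat_recr //=; have := Ve t; have := IH Tt; lra.
Qed.

(** Once [V] is small at a time when the tail of [e] is small too, it can never climb back. *)
Lemma quasi_decreasing_vanishes (R : realType) (V e : nat -> R) :
  (forall t, 0 <= e t) -> (forall t, V t.+1 <= V t + e t) -> bounded_sums e ->
  recurrent V -> vanishes V.
Proof.
move=> e0 Ve eb Vrec eps eps0.
have eps2 : 0 < eps / 2 by rewrite divr_gt0.
have [N NP] := bounded_sums_tail e0 eb eps2.
have [T NT VT] := Vrec _ N eps2; exists T => t Tt.
have := quasi_decreasing_le Ve Tt; have := NP T t NT; lra.
Qed.

(** * Stationary weights of an irreducible stochastic matrix *)

(* The entrywise absolute value of a left fixed vector is still one, because the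
   total mass is preserved; irreducibility then excludes zero entries. *)
Lemma stationary_weights (R : realType) n (w : 'I_n -> 'I_n -> R) :
  (forall i j, 0 <= w i j) -> (forall i, \sum_j w i j = 1) ->
  (forall i j, connect (fun i j => 0 < w i j) i j) ->
  exists2 p : 'I_n -> R, (forall i, 0 < p i) &
    forall j, \sum_i p i * w i j = p j.
Proof.
case: n w => [|n] w w0 w1 wc; first by exists (fun=> 1) => -[].
pose W : 'M[R]_n.+1 := \matrix_(i, j) w i j.
(* Row sums equal to 1 make the constant vector a right fixed vector; the determinant transfers
   singularity to the left side. *)
have : \det (1%:M - W) == 0.
  rewrite -det_tr; apply/det0P; exists (const_mx 1).
    by apply/eqP => /rowP /(_ ord0) /eqP; rewrite !mxE oner_eq0.
  apply/rowP => i; rewrite !mxE.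
  under eq_bigr do rewrite !mxE mul1r.
  rewrite sumrB w1 (bigD1 i) //= eqxx big1 ?addr0 ?subrr // => j /negPf.
  by rewrite eq_sym => ->.
move/det0P => [v v_neq0 vW].
have vE j : \sum_i v 0 i * w i j = v 0 j.
  have /rowP /(_ j) := vW; rewrite mulmxBr mulmx1 !mxE => /eqP.
  by rewrite subr_eq0 => /eqP ->; apply: eq_bigr => i _; rewrite !mxE.
pose p i := `|v 0 i|.
have ple j : p j <= \sum_i p i * w i j.
  rewrite {1}/p -vE (le_trans (ler_norm_sum _ _ _)) //.
  by apply: ler_sum => i _; rewrite normrM (ger0_norm (w0 _ _)).
have pE j : \sum_i p i * w i j = p j.
  apply/eqP; rewrite eq_sym -subr_eq0 -oppr_eq0 opprB; apply/eqP.
  (* The differences are nonnegative by [ple], so a zero total makes each of them zero. *)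
  have : \sum_j (\sum_i p i * w i j - p j) = 0.
    rewrite sumrB exchange_big /=; apply/eqP; rewrite subr_eq0; apply/eqP.
    by apply: eq_bigr => i _; rewrite -mulr_sumr w1 mulr1.
  by move/psumr_eq0P => -> // i _; rewrite subr_ge0.
exists p => // i; rewrite lt_def normr_ge0 andbT; apply/negP => pi0.
(* A zero entry spreads backwards along edges, hence to every index, which contradicts [v != 0]. *)
have zero_pred j k' : p j = 0 -> 0 < w k' j -> p k' = 0.
  move=> pj0 wkj; have sum0 : \sum_i p i * w i j = 0 by rewrite pE.
  have pw0 l : true -> 0 <= p l * w l j by move=> _; rewrite mulr_ge0 ?normr_ge0.
  have : p k' * w k' j = 0 by apply: (psumr_eq0P pw0 sum0).
  by move/eqP; rewrite mulf_eq0 (gt_eqF wkj) orbF => /eqP.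
case/negP: v_neq0; apply/eqP/rowP => k; rewrite mxE.
apply/eqP; rewrite -normr_eq0 -/(p k); apply/eqP.
have /connectP [s] := wc k i.
elim: s k => [|k' s IH] k /=; first by move=> _ <-; apply/eqP.
by move=> /andP[wkk' path_s] /(IH k' path_s) pk'; apply: zero_pred wkk'.
Qed.

(** * Topology through the squared norm *)

(** Balls of row vectors are entrywise, and each squared entry is at most [sqnorm]. *)
Lemma nbhs_sqnorm (R : realType) m (p : 'rV[R]_m) (A : set 'rV[R]_m) :
  nbhs p A -> exists2 r : R, 0 < r & forall y, sqnorm (y - p) < r -> A y.
Proof.
move=> /nbhs_ballP [e /= e0 eA]; exists (e ^+ 2); first by rewrite exprn_gt0.
move=> y ype; apply: eA; split=> // i j; rewrite ord1 /ball /= distrC.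
rewrite -ltr_sqr ?nnegrE ?(ltW e0) // real_normK ?num_real //.
apply: le_lt_trans ype; rewrite /sqnorm /dotv (bigD1 j) //= -expr2 !mxE.
by rewrite lerDl sumr_ge0 // => k _; rewrite -expr2 sqr_ge0.
Qed.

Lemma sqnorm_nbhs (R : realType) m (p : 'rV[R]_m) (r : R) :
  0 < r -> nbhs p [set y | sqnorm (y - p) < r].
Proof.
move=> r0; have c0 : 0 < r / m.+1%:R by rewrite divr_gt0.
(* Each of the [m] squared entries is at most r / (m + 1); using m + 1 keeps the sum strictly below
   [r] and covers [m = 0]. *)
apply/nbhs_ballP; exists (Num.sqrt (r / m.+1%:R)) => /=; first by rewrite sqrtr_gt0.
move=> y [_ yp]; rewrite /sqnorm /dotv.
apply: (@le_lt_trans _ _ (\sum_(k < m) r / m.+1%:R)).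
  apply: ler_sum => k _; rewrite -expr2 -(sqr_sqrtr (ltW c0)) !mxE.
  rewrite -real_normK ?num_real // ler_sqr ?nnegrE ?sqrtr_ge0 //.
  by have := yp ord0 k; rewrite /ball /= distrC => /ltW.
rewrite sumr_const card_ord -[ltLHS]mulr_natr mulrAC ltr_pdivrMr // ltr_pM2l //.
by rewrite ltr_nat.
Qed.

Lemma cvg_sqnorm (R : realType) m (u : nat -> 'rV[R]_m) p :
  vanishes (fun t => sqnorm (u t - p)) ->
  u t @[t --> \oo] --> p.
Proof.
move=> up A /nbhs_sqnorm [r r0 rA]; have [N NP] := up r r0.
by exists N => // t /= /NP /rA.
Qed.

Lemma cvg_enorm0 (R : realType) m (u : nat -> 'rV[R]_m) :
  vanishes (fun t => sqnorm (u t)) ->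
  enorm (u t) @[t --> \oo] --> 0.
Proof.
move=> u0; apply/cvgr0Pnorm_lt => e e0.
have [N NP] := u0 (e ^+ 2) (exprn_gt0 _ e0).
exists N => // t /= /NP ut; rewrite ger0_norm ?sqrtr_ge0 //.
by rewrite -[e]ger0_norm ?(ltW e0) // -sqrtr_sqr ltr_sqrt ?exprn_gt0.
Qed.

(** Bolzano-Weierstrass: the sequence stays in a compact box of half-width [Num.sqrt B] centred at
    [z]. *)
Lemma bounded_cluster (R : realType) m (u : nat -> 'rV[R]_m) z (B : R) :
  (forall t, sqnorm (u t - z) <= B) ->
  exists p, recurrent (fun t => sqnorm (u t - p)).
Proof.
move=> uB; have B0 : 0 <= B by apply: le_trans (uB 0%N); exact: sqnorm_ge0.
pose b := Num.sqrt B.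
have cK := @rV_compact R m (fun i => `[z ord0 i - b, z ord0 i + b]%classic)
  (fun i => @segment_compact R _ _).
have [|p [_ pu]] := cK (u t @[t --> \oo]).
  exists 0%N => // t _ i; rewrite /= in_itv /= -ler_distl.
  rewrite -[leLHS]ger0_norm // -sqrtr_sqr ler_sqrt //.
  apply: le_trans (uB t); rewrite real_normK ?num_real // /sqnorm /dotv.
  rewrite (bigD1 i) //= -expr2 !mxE lerDl sumr_ge0 // => k _.
  by rewrite -expr2 sqr_ge0.
exists p => e N e0.
have [|y [[t /= Nt <-] ?]] :=
  pu [set u t | t in [set t | (N <= t)%N]] _ _ (sqnorm_nbhs p e0).
  by exists N => // t Nt; exists t.
by exists t.
Qed.

(** The cluster point is taken along times at which [f] tends to 0, so that both terms are small
    simultaneously. *)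
Lemma recurrent_cluster (R : realType) m (u : nat -> 'rV[R]_m) z (B : R) f :
  (forall t, sqnorm (u t - z) <= B) -> recurrent f ->
  exists p, recurrent (fun t => sqnorm (u t - p) + f t).
Proof.
move=> uB f0.
(* Monotonicity of [tau] is not requested: [k <= tau k] already gives arbitrarily late times. *)
have /choice [tau tauP] : forall k, exists t, (k <= t)%N /\ f t < k.+1%:R^-1.
  by move=> k; have [|t] := f0 k.+1%:R^-1 k; [rewrite invr_gt0|exists t].
have [p pu] := bounded_cluster (fun k => uB (tau k)).
exists p => e N e0; have e2 : 0 < e / 2 by rewrite divr_gt0.
pose M := Num.bound (e / 2)^-1.
have [k] := pu _ (maxn N M) e2; rewrite geq_max => /andP[Nk Mk] uk.
have [tk fk] := tauP k; exists (tau k); first exact: leq_trans Nk tk.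
have : k.+1%:R^-1 < e / 2.
  rewrite invf_plt ?posrE //; apply: lt_le_trans (archi_boundP _) _.
    by rewrite invr_ge0 ltW.
  by rewrite ler_nat; exact: leq_trans Mk (leqnSn k).
move=> kinv; rewrite [ltRHS]splitr ltrD //; exact: lt_trans kinv.
Qed.

Lemma closed_sqnorm (R : realType) m (A : set 'rV[R]_m) p :
  closed A -> (forall e : R, 0 < e -> exists2 y, A y & sqnorm (y - p) < e) -> A p.
Proof.
move=> cA Ap; apply: cA => B /nbhs_sqnorm [r r0 rB].
by have [y Ay /rB By] := Ap r r0; exists y.
Qed.

(** * The projected consensus dynamics *)

Section Dynamics.
Variables (R : realType) (n m : nat) (w : 'I_n -> 'I_n -> R).
Variables (g : 'I_n -> 'rV[R]_m -> R) (dg : 'I_n -> 'rV[R]_m -> 'rV[R]_m).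
Variables (X : 'I_n -> set 'rV[R]_m) (P : 'I_n -> 'rV[R]_m -> 'rV[R]_m).
Variables (C : R) (alpha beta : nat -> R) (x : nat -> 'I_n -> 'rV[R]_m).

(* [mixed] and [descended] are the y_i and xi_i of the algorithm. *)
Definition mixed t i := \sum_j w i j *: x t j.
Definition descended t i := mixed t i - beta t *: dg i (mixed t i).

Hypothesis w_ge0 : forall i j, 0 <= w i j.
Hypothesis w_diag : forall i, 0 < w i i.
Hypothesis w_sum1 : forall i, \sum_j w i j = 1.
Hypothesis w_connected : forall i j, connect (fun i j => 0 < w i j) i j.
Hypothesis X_closed : forall i, closed (X i).
Hypothesis X_convex : forall i, convex_set (X i).
Hypothesis P_proj : forall i, is_proj (X i) (P i).
Hypothesis g_continuous : forall i, continuous (g i).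
Hypothesis dg_subgrad : forall i, is_subgrad_plus (g i) (dg i).
Hypothesis C_ge0 : 0 <= C.
Hypothesis dg_bounded : forall i y, sqnorm (dg i y) <= C.
Hypothesis alpha01 : forall t, 0 <= alpha t <= 1.
Hypothesis alpha_unbounded : ~ bounded_sums alpha.
Hypothesis beta_ge0 : forall t, 0 <= beta t.
Hypothesis beta_unbounded : ~ bounded_sums beta.
Hypothesis beta2_bounded : bounded_sums (fun t => beta t ^+ 2).
Hypothesis dynamics : forall t i, x t.+1 i =
  descended t i - alpha t *: (descended t i - P i (descended t i)).

Variable p : 'I_n -> R.
Hypothesis p_gt0 : forall i, 0 < p i.
Hypothesis p_stationary : forall j, \sum_i p i * w i j = p j.

Let mass := \sum_i p i.
Definition lyapunov z t := \sum_i p i * sqnorm (x t i - z).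
Definition mixing t :=
  \sum_i p i * (\sum_j w i j * sqnorm (x t j - mixed t i)).
Definition violation t := \sum_i p i * Num.max (g i (mixed t i)) 0.
Definition infeasibility t :=
  \sum_i p i * sqnorm (descended t i - P i (descended t i)).

(** * Energy estimates for one step of the dynamics *)

Lemma weighted_term_le (F : 'I_n -> R) i :
  (forall j, 0 <= F j) -> p i * F i <= \sum_j p j * F j.
Proof.
move=> F0; rewrite [leRHS](bigD1 i) //= lerDl sumr_ge0 // => j _.
by rewrite mulr_ge0 // ltW.
Qed.

Lemma weighted_sum_ge0 (F : 'I_n -> R) :
  (forall j, 0 <= F j) -> 0 <= \sum_j p j * F j.
Proof. by move=> F0; apply: sumr_ge0 => i _; rewrite mulr_ge0 // ltW. Qed.

Lemma mass_ge0 : 0 <= mass.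
Proof. by apply: sumr_ge0 => i _; rewrite ltW. Qed.

Lemma max0_ge0 (r : R) : 0 <= Num.max r 0.
Proof. by rewrite le_max lexx orbT. Qed.

Lemma lyapunov_ge0 z t : 0 <= lyapunov z t.
Proof. by apply: weighted_sum_ge0 => i; exact: sqnorm_ge0. Qed.

Lemma mixing_ge0 t : 0 <= mixing t.
Proof.
apply: weighted_sum_ge0 => i; apply: sumr_ge0 => j _.
by rewrite mulr_ge0 // sqnorm_ge0.
Qed.

Lemma violation_ge0 t : 0 <= violation t.
Proof. by apply: weighted_sum_ge0 => i; exact: max0_ge0. Qed.

Lemma infeasibility_ge0 t : 0 <= infeasibility t.
Proof. by apply: weighted_sum_ge0 => i; exact: sqnorm_ge0. Qed.

(** Sum [sqnorm_mean] over agents with weights [p]: after exchanging sums, stationarity restores the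
    coefficient [p j] of each |x_j - z|^2. *)
Lemma lyapunov_mixed z t :
  \sum_i p i * sqnorm (mixed t i - z) + mixing t = lyapunov z t.
Proof.
rewrite -big_split /=.
under eq_bigr do rewrite -mulrDr sqnorm_mean // mulr_sumr.
rewrite exchange_big /=; apply: eq_bigr => j _.
by under eq_bigr do rewrite mulrA; rewrite -mulr_suml p_stationary.
Qed.

Lemma sqnorm_le_lyapunov z t i : p i * sqnorm (x t i - z) <= lyapunov z t.
Proof.
apply: (weighted_term_le (F := fun i => sqnorm (x t i - z))) => j.
exact: sqnorm_ge0.
Qed.

Lemma sqnorm_mixed_le_lyapunov z t i :
  p i * sqnorm (mixed t i - z) <= lyapunov z t.
Proof.
rewrite -(lyapunov_mixed z t); apply: ler_wpDr; first exact: mixing_ge0.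
apply: (weighted_term_le (F := fun i => sqnorm (mixed t i - z))) => j.
exact: sqnorm_ge0.
Qed.

Lemma sqnorm_le_infeasibility t i :
  p i * sqnorm (descended t i - P i (descended t i)) <= infeasibility t.
Proof.
apply: (weighted_term_le
  (F := fun i => sqnorm (descended t i - P i (descended t i)))) => j.
exact: sqnorm_ge0.
Qed.

Lemma max_le_violation t i :
  p i * Num.max (g i (mixed t i)) 0 <= violation t.
Proof.
apply: (weighted_term_le (F := fun i => Num.max (g i (mixed t i)) 0)) => j.
exact: max0_ge0.
Qed.

Lemma sqnorm_le_mixing t i j :
  p i * (w i j * sqnorm (x t j - mixed t i)) <= mixing t.
Proof.
have w_sq k l : 0 <= w k l * sqnorm (x t l - mixed t k).
  by rewrite mulr_ge0 // sqnorm_ge0.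
apply: le_trans (weighted_term_le
  (F := fun i => \sum_j w i j * sqnorm (x t j - mixed t i)) i _).
  by rewrite ler_pM2l // (bigD1 j) //= lerDl sumr_ge0.
by move=> k; apply: sumr_ge0.
Qed.

(** The projection gain comes from [relaxed_proj_le], the rest from expanding the subgradient step.
    The inner product is kept as it is, to be estimated differently in [lyapunov_descent] and
    [lyapunov_step]. *)
Lemma step_le z t i : X i z ->
  sqnorm (x t.+1 i - z) +
    alpha t * sqnorm (descended t i - P i (descended t i)) <=
  sqnorm (mixed t i - z) - 2 * beta t * dotv (dg i (mixed t i)) (mixed t i - z)
    + beta t ^+ 2 * C.
Proof.
move=> Xz; rewrite dynamics.
apply: le_trans (relaxed_proj_le _ (@X_convex i) (@P_proj i) Xz (alpha01 t)) _.
rewrite /descended addrAC; set y := mixed t i; set d := dg i y.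
have dC : beta t ^+ 2 * sqnorm d <= beta t ^+ 2 * C.
  by rewrite ler_wpM2l ?sqr_ge0 ?dg_bounded.
move: dC; rewrite /sqnorm; move: (y - z) => u.
rewrite !dotvE (dotvC u d); lra.
Qed.

Lemma lyapunov_descent z t : (forall i, g i z <= 0) -> (forall i, X i z) ->
  lyapunov z t.+1 + (mixing t + 2 * (beta t * violation t) +
    alpha t * infeasibility t) <= lyapunov z t + C * mass * beta t ^+ 2.
Proof.
move=> gz Xz; rewrite -(lyapunov_mixed z t).
suff : lyapunov z t.+1 + alpha t * infeasibility t + 2 * (beta t * violation t) <=
    \sum_i p i * sqnorm (mixed t i - z) + C * mass * beta t ^+ 2 by lra.
have -> : C * mass * beta t ^+ 2 = \sum_i p i * (C * beta t ^+ 2).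
  by rewrite -mulr_suml -/mass; ring.
rewrite /lyapunov /infeasibility /violation !mulr_sumr -!big_split /=.
apply: ler_sum => i _.
have := step_le t (Xz i).
have := subgrad_dotv_ge (mixed t i) (@dg_subgrad i) (gz i).
set G := Num.max _ _; set s := sqnorm _; set s' := sqnorm _; set s'' := sqnorm _.
set d := dotv _ _ => Gd step.
have : 0 <= p i * (s'' + C * beta t ^+ 2 - s - alpha t * s' - 2 * (beta t * G)).
  rewrite mulr_ge0 ?(ltW (p_gt0 i)) //.
  have := ler_wpM2l (beta_ge0 t) Gd; lra.
lra.
Qed.

(** For points of all the [X i] that may violate some [g i <= 0]: the energy can then grow, but only
    at a rate governed by [beta], never by [alpha]. *)
Lemma lyapunov_step z t : (forall i, X i z) ->
  lyapunov z t.+1 <=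
  lyapunov z t + (C * mass + lyapunov z t) * beta t + C * mass * beta t ^+ 2.
Proof.
move=> Xz; set V := lyapunov z t.
have yV : \sum_i p i * sqnorm (mixed t i - z) <= V.
  by rewrite /V -(lyapunov_mixed z t) lerDl mixing_ge0.
apply: (@le_trans _ _ (\sum_i (p i * sqnorm (mixed t i - z) +
    beta t * (C * p i + p i * sqnorm (mixed t i - z)) + C * p i * beta t ^+ 2))).
  apply: ler_sum => i _; have := step_le t (Xz i).
  have a0 : 0 <= alpha t * sqnorm (descended t i - P i (descended t i)).
    by rewrite mulr_ge0 ?sqnorm_ge0 //; case/andP: (alpha01 t).
  (* Gives - 2 <d, u> <= |d|^2 + |u|^2 with u = y - z, in place of the subgradient inequality. *)
  have := sqnorm_ge0 (dg i (mixed t i) + (mixed t i - z)).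
  have := dg_bounded i (mixed t i).
  rewrite {2}/sqnorm; move: a0.
  set s0 := alpha t * _; set s' := sqnorm (x _ _ - z); set d := dg _ _.
  move=> s00; rewrite /sqnorm; move: (mixed t i - z) => u.
  rewrite !dotvE (dotvC u d); set dd := dotv d d; set du := dotv d u.
  set uu := dotv u u => ddC sq step.
  have bsq : 0 <= beta t * (C + uu + 2 * du) by rewrite mulr_ge0 //; lra.
  have : 0 <= p i * (uu + beta t * (C + uu) + C * beta t ^+ 2 - s').
    by rewrite mulr_ge0 ?(ltW (p_gt0 i)) //; lra.
  lra.
rewrite !big_split /= -mulr_sumr -mulr_suml big_split /= -!mulr_sumr -/mass.
have := ler_wpM2l (beta_ge0 t) yV; lra.
Qed.

(** * Summability, consensus and convergence, given a solution of the CFP *)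

Section Feasible.
Variable z : 'rV[R]_m.
Hypothesis gz : forall i, g i z <= 0.
Hypothesis Xz : forall i, X i z.

Lemma noise_bounded : bounded_sums (fun t => C * mass * beta t ^+ 2).
Proof. by apply: bounded_sumsZ => //; rewrite mulr_ge0 ?mass_ge0. Qed.

Lemma descent_bounded : bounded_sums (fun t =>
  mixing t + 2 * (beta t * violation t) + alpha t * infeasibility t).
Proof.
apply: (quasi_decreasing_bounded_sums (V := lyapunov z) _ _ noise_bounded).
  exact: lyapunov_ge0.
by move=> t; exact: lyapunov_descent.
Qed.

Lemma violation_term_ge0 t : 0 <= beta t * violation t.
Proof. by rewrite mulr_ge0 // violation_ge0. Qed.

Lemma infeasibility_term_ge0 t : 0 <= alpha t * infeasibility t.
Proof. by rewrite mulr_ge0 ?infeasibility_ge0 //; case/andP: (alpha01 t). Qed.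

Lemma violation_bounded : bounded_sums (fun t => beta t * violation t).
Proof.
apply: bounded_sums_le descent_bounded => t.
have := mixing_ge0 t; have := violation_term_ge0 t.
have := infeasibility_term_ge0 t; lra.
Qed.

(** Summability weighted by [alpha] controls the residuals only along a subsequence, since [alpha]
    may be tiny at other times. *)
Lemma infeasibility_recurrent : recurrent infeasibility.
Proof.
apply: weighted_sums_recurrent alpha_unbounded _.
- by move=> t; case/andP: (alpha01 t).
- exact: infeasibility_ge0.
apply: bounded_sums_le descent_bounded => t.
have := mixing_ge0 t; have := violation_term_ge0 t.
have := infeasibility_term_ge0 t; lra.
Qed.

Lemma lyapunov_bounded : exists B, forall t, lyapunov z t <= B.
Proof.
have [B Bub] := noise_bounded; exists (lyapunov z 0%N + B) => t.
have Vs s : lyapunov z s.+1 <= lyapunov z s + C * mass * beta s ^+ 2.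
  apply: le_trans (lyapunov_descent s gz Xz).
  have := mixing_ge0 s; have := violation_term_ge0 s.
  have := infeasibility_term_ge0 s; lra.
by apply: (le_trans (quasi_decreasing_le Vs (leq0n t))); rewrite lerD2l.
Qed.

Lemma mixing_vanishes : vanishes mixing.
Proof.
apply: bounded_sums_vanishes; first exact: mixing_ge0.
apply: bounded_sums_le descent_bounded => t.
have := violation_term_ge0 t; have := infeasibility_term_ge0 t; lra.
Qed.

Lemma edge_vanishes i j :
  0 < w i j -> vanishes (fun t => sqnorm (x t j - mixed t i)).
Proof.
move=> wij; apply: (@vanishes_le _ _ (fun t => (p i * w i j)^-1 * mixing t)).
  by move=> t; rewrite ler_pdivlMl ?mulr_gt0 // -mulrA sqnorm_le_mixing.
by apply: vanishesZ mixing_vanishes; rewrite invr_ge0 mulr_ge0 // ltW.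
Qed.

Lemma consensus i j : vanishes (fun t => sqnorm (x t i - x t j)).
Proof.
have /connectP [s] := w_connected i j.
elim: s i => [|k s IH] i /=.
  move=> _ ->; move=> e e0; exists 0%N => t _.
  by rewrite subrr /sqnorm dotv0l.
move=> /andP[wik path_s] /(IH k path_s) kj.
(* Both x_i and x_k approach the mean y_i, the former thanks to the positive diagonal. Splitting
   squares twice produces the factors 4 and 2 below. *)
have ik := vanishesD (edge_vanishes (w_diag i)) (edge_vanishes wik).
apply: vanishes_le
  (vanishesD (vanishesZ (c := 4) _ ik) (vanishesZ (c := 2) _ kj)) => //.
move=> t; have := sqnormB_le (x t i) (x t k) (x t j).
have := sqnormB_le (x t i) (mixed t i) (x t k).
rewrite (sqnormBC (mixed t i) (x t k)); lra.
Qed.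

(** A cluster point of agent [i0] is shared by all agents through consensus; taken at times of small
    [infeasibility], it is a limit of projected points of each [X i]. *)
Lemma cluster_in_X (i0 : 'I_n) :
  exists2 q, recurrent (lyapunov q) & forall i, X i q.
Proof.
have [B VB] := lyapunov_bounded.
have xB t : sqnorm (x t i0 - z) <= B / p i0.
  rewrite ler_pdivlMr // mulrC; apply: le_trans (VB t).
  exact: sqnorm_le_lyapunov.
have [q qrec] := recurrent_cluster xB infeasibility_recurrent.
have spread_vanishes : vanishes (fun t => \sum_i p i * sqnorm (x t i - x t i0)).
  apply: (vanishes_sum (f := fun i t => p i * sqnorm (x t i - x t i0))) => i.
  by apply: vanishesZ (consensus i i0); exact: ltW.
have joint : recurrent (fun t => lyapunov q t + infeasibility t).
  apply: recurrent_le (recurrentD (recurrentZ (c := 2 * mass + 1) _ qrec)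
    (vanishesZ (c := 2) _ spread_vanishes)) => //; last first.
    by have := mass_ge0; lra.
  move=> t; have : lyapunov q t <= 2 * \sum_i p i * sqnorm (x t i - x t i0) +
      2 * mass * sqnorm (x t i0 - q).
    rewrite mulr_sumr (mulrAC 2) mulr_sumr -big_split /=; apply: ler_sum => i _.
    have := ler_wpM2l (ltW (p_gt0 i)) (sqnormB_le (x t i) (x t i0) q); lra.
  have := mulr_ge0 mass_ge0 (infeasibility_ge0 t).
  have := sqnorm_ge0 (x t i0 - q); have := infeasibility_ge0 t; lra.
exists q => [|i].
  by apply: recurrent_le joint => t; rewrite lerDl infeasibility_ge0.
apply: closed_sqnorm => // e e0.
(* The subgradient displacement is at most C beta^2 in square. Splitting P_i xi_i - q through xi_i
   and then y_i yields the constants 4 / p_i and 4 C. *)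
have := beta2_bounded => /(bounded_sums_vanishes (fun t => sqr_ge0 _)) b0.
have p4 : 0 <= 4 / p i by rewrite divr_ge0 // ltW.
have C4 : 0 <= 4 * C by rewrite mulr_ge0.
have [t _] := recurrentD (recurrentZ p4 joint) (vanishesZ C4 b0) 0%N e0.
move=> small; exists (P i (descended t i)).
  by case: (P_proj i (descended t i)).
apply: le_lt_trans small.
have pinf : sqnorm (descended t i - P i (descended t i)) <=
    (p i)^-1 * infeasibility t.
  by rewrite ler_pdivlMl // sqnorm_le_infeasibility.
have pmix : sqnorm (mixed t i - q) <= (p i)^-1 * lyapunov q t.
  by rewrite ler_pdivlMl // sqnorm_mixed_le_lyapunov.
have := sqnormB_le (P i (descended t i)) (descended t i) q.
have := sqnormB_le (descended t i) (mixed t i) q.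
have : sqnorm (descended t i - mixed t i) <= beta t ^+ 2 * C.
  rewrite /descended addrAC subrr add0r -scaleNr sqnormZ sqrrN.
  by rewrite ler_wpM2l ?sqr_ge0.
rewrite (sqnormBC (P i _) (descended t i)).
have := sqnorm_ge0 (descended t i - P i (descended t i)).
lra.
Qed.

(* A violated constraint at q forces the steps beta, hence the drift away from
   q, to be summable as long as the states stay near q; so they stay there
   forever, and the whole series of the beta's converges. *)
Lemma cluster_feasible q : recurrent (lyapunov q) -> (forall i, X i q) ->
  forall i, g i q <= 0.
Proof.
move=> qrec Xq i; rewrite leNgt; apply/negP => gq.
have c0 : 0 < g i q / 2 by rewrite divr_gt0.
set c := g i q / 2 in c0.
have : nbhs q [set y | c < g i y].
  have cq : c < g i q by rewrite /c; lra.
  exact: (cvgr_gt (g i q) (@g_continuous i q)).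
move=> /nbhs_sqnorm [r r0 rP].
(* An energy below [p i * r] forces y_i within squared distance [r] of [q], where [g i] exceeds
   [c]. *)
pose eta := p i * r; have eta0 : 0 < eta by rewrite mulr_gt0.
have near_q t : lyapunov q t < eta ->
    beta t <= (p i * c)^-1 * (beta t * violation t).
  move=> Vt; rewrite ler_pdivlMl ?mulr_gt0 // mulrC ler_wpM2l //.
  have yr : sqnorm (mixed t i - q) < r.
    rewrite -(ltr_pM2l (p_gt0 i)); apply: le_lt_trans Vt.
    exact: sqnorm_mixed_le_lyapunov.
  apply: le_trans (max_le_violation t i).
  by rewrite ler_pM2l // le_max (ltW (rP _ yr)).
(* While the energy is below [eta], the growth factor of [lyapunov_step] is at most
   [C * mass + eta], and [near_q] trades [beta] for the summable violation term. *)
pose k := (C * mass + eta) * (p i * c)^-1.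
have k0 : 0 <= k.
  apply: mulr_ge0; last by rewrite invr_ge0 mulr_ge0 // ltW.
  by rewrite addr_ge0 ?(ltW eta0) // mulr_ge0 // mass_ge0.
pose e t := k * (beta t * violation t) + C * mass * beta t ^+ 2.
have e0 t : 0 <= e t.
  apply: addr_ge0; first exact: (mulr_ge0 k0 (violation_term_ge0 t)).
  by rewrite !mulr_ge0 ?sqr_ge0 ?mass_ge0.
have eb : bounded_sums e.
  by apply: bounded_sumsD noise_bounded; apply: bounded_sumsZ violation_bounded.
have eta2 : 0 < eta / 2 by rewrite divr_gt0.
have [N NP] := bounded_sums_tail e0 eb eta2.
have [T NT VT] := qrec _ N eta2.
(* Start and accumulated increments are each below [eta / 2], so the bound at [t] keeps the energy
   below [eta] and permits the next step. *)
have trapped t : (T <= t)%N -> lyapunov q t <= lyapunov q T + \sum_(T <= s < t) e s.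
  elim: t => [|t IH].
    by rewrite leqn0 => /eqP ->; rewrite big_geq ?addr0.
  rewrite leq_eqVlt => /predU1P[->|]; first by rewrite big_geq ?addr0.
  rewrite ltnS => Tt; have Vt := IH Tt; rewrite big_nat_recr //= addrA.
  apply: le_trans (lerD Vt (lexx _)); rewrite /e.
  have Veta : lyapunov q t < eta by have := NP T t NT; lra.
  have := lyapunov_step t Xq.
  have : (C * mass + lyapunov q t) * beta t <= k * (beta t * violation t).
    rewrite /k -mulrA; apply: (@le_trans _ _ ((C * mass + eta) * beta t)).
      by rewrite ler_wpM2r // lerD2l ltW.
    apply: ler_wpM2l (near_q _ Veta).
    by rewrite addr_ge0 ?(ltW eta0) // mulr_ge0 // mass_ge0.
  lra.
apply: beta_unbounded.
apply: (bounded_sums_eventually_le (N := T) _ _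
  (bounded_sumsZ (c := (p i * c)^-1) _ violation_bounded)).
- move=> t; rewrite mulr_ge0 ?violation_term_ge0 // invr_ge0 mulr_ge0 // ltW //.
- move=> t Tt; apply: near_q; have := trapped t Tt; have := NP T t NT; lra.
- by rewrite invr_ge0 mulr_ge0 // ltW.
Qed.

(** The cluster point [q] is itself a solution, so [lyapunov_descent] applies at [q]; being
    recurrent and quasi-decreasing, the energy there vanishes. *)
Lemma common_limit (i0 : 'I_n) : exists q,
  ((forall i, g i q <= 0) /\ (forall i, X i q)) /\
  forall i, vanishes (fun t => sqnorm (x t i - q)).
Proof.
have [q qrec Xq] := cluster_in_X i0; have gq := cluster_feasible qrec Xq.
exists q; split=> // i.
apply: (@vanishes_le _ _ (fun t => (p i)^-1 * lyapunov q t)).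
  by move=> t; rewrite ler_pdivlMl // sqnorm_le_lyapunov.
apply: vanishesZ; first by rewrite invr_ge0 ltW.
apply: quasi_decreasing_vanishes noise_bounded qrec.
  by move=> t; rewrite !mulr_ge0 ?sqr_ge0 ?mass_ge0.
move=> t; apply: le_trans (lyapunov_descent t gq Xq).
have := mixing_ge0 t; have := violation_term_ge0 t.
have := infeasibility_term_ge0 t; lra.
Qed.

End Feasible.
End Dynamics.

(** * The averaging step as a stochastic matrix *)

(** The matrix I - hL, with L the Laplacian of [a]. *)
Definition gossip_weight (R : realType) n (a : 'I_n -> 'I_n -> R) (h : R) i j :=
  if i == j then 1 - h * \sum_k a i k else h * a i j.

Section GossipWeight.
Variables (R : realType) (n m : nat) (a : 'I_n -> 'I_n -> R) (h : R).
Hypothesis a_ge0 : forall i j, 0 <= a i j.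
Hypothesis a_diag : forall i, a i i = 0.
Hypothesis h_gt0 : 0 < h.
Hypothesis h_lt : forall i, h * (\sum_j a i j) < 1.

Lemma gossip_weight_diag i : 0 < gossip_weight a h i i.
Proof. by rewrite /gossip_weight eqxx subr_gt0. Qed.

Lemma gossip_weight_ge0 i j : 0 <= gossip_weight a h i j.
Proof.
have := gossip_weight_diag i; rewrite /gossip_weight eqxx => /ltW.
by case: eqP => // _ _; rewrite mulr_ge0 // ltW.
Qed.

Lemma gossip_weight_sum1 i : \sum_j gossip_weight a h i j = 1.
Proof.
rewrite (bigD1 i) //= {1}/gossip_weight eqxx (bigD1 i) //= a_diag add0r.
rewrite mulr_sumr addrAC -addrA -sumrB big1 ?addr0 // => j ji.
by rewrite /gossip_weight eq_sym (negPf ji) subrr.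
Qed.

Lemma gossip_weight_connected : strongly_connected a ->
  forall i j, connect (fun i j => 0 < gossip_weight a h i j) i j.
Proof.
move=> ca i j; apply: connect_sub (ca i j) => k l akl; apply: connect1.
rewrite /gossip_weight; case: eqP => [_|_]; last by rewrite mulr_gt0.
by rewrite subr_gt0.
Qed.

(** Since rows sum to 1, x_i can be subtracted under the sum, and the two sides then agree term by
    term. *)
Lemma gossip_weight_mean (x : 'I_n -> 'rV[R]_m) i :
  x i + h *: nbsum a x i = \sum_j gossip_weight a h i j *: x j.
Proof.
rewrite -[RHS](subrKC (x i)); congr (_ + _).
rewrite -[X in _ = _ - X]scale1r -(gossip_weight_sum1 i) scaler_suml -sumrB.
rewrite /nbsum big_mkcond scaler_sumr; apply: eq_bigr => j _.
rewrite -scalerBr /gossip_weight; case: eqP => [<-|_].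
  by rewrite subrr !scaler0 if_same scaler0.
case: ifP => [_|/negbT]; first by rewrite scalerA.
rewrite -leNgt => aij; have -> : a i j = 0 by apply/eqP; rewrite eq_le aij a_ge0.
by rewrite mulr0 scaler0 scale0r.
Qed.

End GossipWeight.

Theorem theorem5 (R : realType) (n m : nat)
  (a : 'I_n -> 'I_n -> R)
  (g : 'I_n -> 'rV[R]_m -> R) (dg : 'I_n -> 'rV[R]_m -> 'rV[R]_m)
  (X : 'I_n -> set 'rV[R]_m) (P : 'I_n -> 'rV[R]_m -> 'rV[R]_m)
  (K h : R) (alpha beta : nat -> R) (x : nat -> 'I_n -> 'rV[R]_m) :
  (forall i j, 0 <= a i j) ->
  (forall i, a i i = 0) ->
  strongly_connected a ->
  (forall i, convex_function [set: 'rV[R]_m] (g i)) ->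
  (forall i, continuous (g i)) ->
  (forall i, closed (X i)) ->
  (forall i, convex_set (X i)) ->
  (forall i, is_proj (X i) (P i)) ->
  (forall i, is_subgrad_plus (g i) (dg i)) ->
  (exists xs, (forall i, g i xs <= 0) /\ (forall i, X i xs)) ->
  0 <= K ->
  (forall i y, enorm (dg i y) <= K) ->
  (forall t, 0 <= alpha t <= 1) ->
  (\sum_(0 <= t <oo) (alpha t)%:E = +oo)%E ->
  (\sum_(0 <= t <oo) (alpha t ^+ 2)%:E < +oo)%E ->
  (forall t, 0 <= beta t) ->
  (\sum_(0 <= t <oo) (beta t)%:E = +oo)%E ->
  (\sum_(0 <= t <oo) (beta t ^+ 2)%:E < +oo)%E ->
  (* 0 < h < varrho *)
  0 < h ->
  (forall i, h * (\sum_(j < n) a i j) < 1) ->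
  (forall lam : R[i], lam != 0 ->
     eigenvalue (map_mx (fun r : R => (r%:C)%C) (laplacian a)) lam ->
     (h%:C)%C * `|lam| ^+ 2 < 2 * 'Re lam) ->
  (* dynamics *)
  (forall t i,
     let v := h *: nbsum a (x t) i in
     let y := x t i + v in
     let nab := beta t *: dg i y in
     let xi := y - nab in
     let vphi := alpha t *: (xi - P i xi) in
     let phi := - nab - vphi in
     x t.+1 i = x t i + (v + phi)) ->
  (forall i j, enorm (x t i - x t j) @[t --> \oo] --> 0) /\
  exists xs, ((forall i, g i xs <= 0) /\ (forall i, X i xs)) /\
             forall i, x t i @[t --> \oo] --> xs.
Proof.
move=> a_ge0 a_diag a_conn _ g_cont X_cl X_conv P_proj dgP [z [gz Xz]] _ dgK
  alpha01 alphaoo _ beta_ge0 betaoo beta2 h_gt0 h_lt _ dyn.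
have alpha_ge0 t : 0 <= alpha t by case/andP: (alpha01 t).
have w_conn := gossip_weight_connected h_gt0 h_lt a_conn.
have w_ge0 := gossip_weight_ge0 a_ge0 h_gt0 h_lt.
have w_sum1 := gossip_weight_sum1 h a_diag.
have w_diag := gossip_weight_diag h_lt.
have [p p_gt0 p_stat] := stationary_weights w_ge0 w_sum1 w_conn.
(* The constant [C] of the dynamics is [K ^+ 2]. *)
have dgK2 i y : sqnorm (dg i y) <= K ^+ 2 by apply: enorm_le_sqr.
have beta2_bounded := nneseries_bounded_sums (fun t => sqr_ge0 (beta t)) beta2.
have beta_unbounded := nneseries_unbounded_sums beta_ge0 betaoo.
have alpha_unbounded := nneseries_unbounded_sums alpha_ge0 alphaoo.
have dyn' t i : x t.+1 i =
    descended (gossip_weight a h) dg beta x t i -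
    alpha t *: (descended (gossip_weight a h) dg beta x t i -
                P i (descended (gossip_weight a h) dg beta x t i)).
  by rewrite dyn /descended /mixed -gossip_weight_mean // !addrA.
split=> [i j|].
  apply: cvg_enorm0.
  exact: (consensus w_ge0 w_diag w_sum1 w_conn X_conv P_proj dgP (sqr_ge0 K)
    dgK2 alpha01 beta_ge0 beta2_bounded dyn' p_gt0 p_stat gz Xz).
(* Without agents, the given solution [z] serves as limit; otherwise any agent can supply the
   cluster point. *)
have [i0 _|no_agent] := pickP 'I_n; last first.
  by exists z; split=> // i; have := no_agent i.
have [q [q_sol xq]] := common_limit w_ge0 w_diag w_sum1 w_conn X_cl X_conv P_proj
  g_cont dgP (sqr_ge0 K) dgK2 alpha01 alpha_unbounded beta_ge0 beta_unbounded
  beta2_bounded dyn' p_gt0 p_stat gz Xz i0.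
by exists q; split=> // i; exact: cvg_sqnorm.
Qed.
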